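(* Let $(T,\mathbf r)$ be the ranked fission tree of $Q$ and $\mathbf U$ the kernel flag of $Q$ (defined below). Then (i) $\operatorname{Stab}_{W_{\mathfrak g}}(\mathbf U)\cong\widetilde{\mathrm{Aut}}(T,\mathbf r)$, where for any ranked tree the group $\widetilde{\mathrm{Aut}}$ is defined recursively by $\widetilde{\mathrm{Aut}}(\text{single node of rank } r)=\mathrm S_r$ and $$\widetilde{\mathrm{Aut}}(T,\mathbf r)=\prod_{t\in\widetilde{\mathcal T}}\mathrm S_{n(t)}\wr\widetilde{\mathrm{Aut}}(t,\mathbf r|_t);$$ (ii) the automorphism group satisfies $\mathrm{Aut}(T,\mathbf r)\cong\prod_{t\in\widetilde{\mathcal T}}\mathrm S_{n(t)}\wr\mathrm{Aut}(t,\mathbf r|_t)$, and the automorphism group of a single-node ranked tree is trivial (so $\mathrm{Aut}(T,\mathbf r)$ is obtained by the same recursion as $\widetilde{\mathrm{Aut}}$ with trivial groups at the leaves).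
   Context: Let $n\ge2$, $\mathfrak g=\mathfrak{sl}_n(\mathbb C)$, $\mathfrak t=\{x\in\mathbb C^n:\sum x_a=0\}$, $W_{\mathfrak g}=\mathrm S_n$ permuting coordinates. Fix $p\ge1$, $A_1,\dots,A_p\in\mathfrak t$. For $l\in\{1,\dots,p+1\}$ let $P_l$ be the partition of $\underline n=\{1,\dots,n\}$ in which $a,b$ lie in the same part iff $(A_j)_a=(A_j)_b$ for all $j$ with $l\le j\le p$ (so $P_{p+1}=\{\underline n\}$). Let $U_l=\{x\in\mathfrak t: x_a=x_b$ whenever $a,b$ are in the same part of $P_l\}$ and $\operatorname{Stab}_{W_{\mathfrak g}}(\mathbf U)=\{w\in\mathrm S_n: w(U_l)\subseteq U_l\ \forall l\in\{1,\dots,p\}\}$. Ranked fission tree $(T,\mathbf r)$: nodes are pairs $(l,L)$ with $L$ a part of $P_l$, $1\le l\le p+1$; the root is $(p+1,\underline n)$; the parent of $(l,L)$, $l\le p$, is $(l+1,L')$ with $L'\supseteq L$ the part of $P_{l+1}$; the rank is $\mathbf r(l,L)=|L|$; leaves are the nodes at level 1. In general a ranked tree is a rooted tree with a positive-integer rank on nodes; an isomorphism of ranked trees is a bijection of node sets sending root to root, commuting with the parent maps and preserving ranks; $\mathrm{Aut}(T,\mathbf r)$ is the group of self-isomorphisms. The maximal proper subtrees of $T$ are the subtrees $t$ consisting of a child of the root and all its descendants, with restricted rank $\mathbf r|_t$; $\widetilde{\mathcal T}$ is a set of representatives of their isomorphism classes and $n(t)$ is the number of maximal proper subtrees isomorphic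 to $t$. For a group $P$ and $m\ge0$, $\mathrm S_m\wr P=\mathrm S_m\ltimes P^m$ with $\sigma\cdot(x_1,\dots,x_m)=(x_{\sigma^{-1}(1)},\dots,x_{\sigma^{-1}(m)})$. *)

(* Defs.v *)
From HB Require Import structures.
From mathcomp Require Import all_boot all_order all_algebra all_fingroup.
From mathcomp Require Import boolp reals complex.
Set Implicit Arguments.
Unset Strict Implicit.
Unset Printing Implicit Defensive.
Import GRing.Theory.

Section Wreath.
Variables (I : finType) (gT : finGroupType).
Definition wreathT := ({perm I} * {ffun I -> gT})%type.
HB.instance Definition _ := Finite.on wreathT.
Definition wr_mul (u v : wreathT) : wreathT :=
  (u.1 * v.1, [ffun i => u.2 i * v.2 (u.1 i)])%g.
Definition wr_one : wreathT := (1, [ffun => 1])%g.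
Definition wr_inv (u : wreathT) : wreathT :=
  (u.1^-1, [ffun i => (u.2 (u.1^-1 i))^-1])%g.
Lemma wr_mulA : associative wr_mul.
Proof.
move=> [s x] [t y] [r z]; rewrite /wr_mul /= mulgA; congr (_, _).
by apply/ffunP=> i; rewrite !ffunE permM mulgA.
Qed.
Lemma wr_mul1 : left_id wr_one wr_mul.
Proof.
move=> [s x]; rewrite /wr_mul /= mul1g; congr (_, _).
by apply/ffunP=> i; rewrite !ffunE perm1 mul1g.
Qed.
Lemma wr_mulV : left_inverse wr_one wr_inv wr_mul.
Proof.
move=> [s x]; rewrite /wr_mul /= mulVg; congr (_, _).
by apply/ffunP=> i; rewrite !ffunE mulVg.
Qed.
HB.instance Definition _ := Finite_isGroup.Build wreathT wr_mulA wr_mul1 wr_mulV.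

(* Sym(S) \wr G, realized on the index set S (a subset of I):
   permutations supported on S, coordinates in G on S and trivial off S. *)
Definition wr_on (S : {set I}) (G : {set gT}) : {set wreathT} :=
  [set u : wreathT | perm_on S u.1 &&
     [forall i, u.2 i \in (if i \in S then G else [set 1%g])]].
End Wreath.

Section ExtProd.
Variables (K : finType) (gT : finGroupType).
Definition prodT := {ffun K -> gT}.
HB.instance Definition _ := Finite.on prodT.
Definition pr_mul (u v : prodT) : prodT := [ffun k => u k * v k]%g.
Definition pr_one : prodT := [ffun => 1]%g.
Definition pr_inv (u : prodT) : prodT := [ffun k => (u k)^-1]%g.
Lemma pr_mulA : associative pr_mul.
Proof. by move=> u v w; apply/ffunP=> k; rewrite !ffunE mulgA. Qed.
Lemma pr_mul1 : left_id pr_one pr_mul.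
Proof. by move=> u; apply/ffunP=> k; rewrite !ffunE mul1g. Qed.
Lemma pr_mulV : left_inverse pr_one pr_inv pr_mul.
Proof. by move=> u; apply/ffunP=> k; rewrite !ffunE mulVg. Qed.
HB.instance Definition _ := Finite_isGroup.Build prodT pr_mulA pr_mul1 pr_mulV.

Definition prod_on (Q : {pred K}) (F : K -> {set gT}) : {set prodT} :=
  [set u : prodT | [forall k, u k \in (if k \in Q then F k else [set 1%g])]].
End ExtProd.

(* The data: n, p, A_1..A_p in t = {x in C^n | sum x = 0}, C = R[i]    *)
(* A j (j : 'I_p) stands for A_{j+1}.                                  *)
Section Fission.
Variables (R : realType) (n p : nat) (A : 'I_p -> 'I_n -> R[i]).

Definition same (l : nat) (a b : 'I_n) : bool :=
  [forall j : 'I_p, (l <= j.+1) ==> (A j a == A j b)].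

Definition Ppart (l : nat) : {set {set 'I_n}} :=
  [set [set b | same l a b] | a : 'I_n].

Definition inU (l : nat) (x : 'I_n -> R[i]) : Prop :=
  (\sum_a x a = 0)%R /\
  forall L a b, L \in Ppart l -> a \in L -> b \in L -> x a = x b.

(* W_g = S_n acting on C^n by permuting coordinates: (w.x)_a = x_{w^-1 a} *)
Definition wact (w : {perm 'I_n}) (x : 'I_n -> R[i]) : 'I_n -> R[i] :=
  fun a => x (w^-1 a)%g.

Definition Stab : {set {perm 'I_n}} :=
  [set w : {perm 'I_n} | `[< forall l, 1 <= l <= p ->
                              forall x, inU l x -> inU l (wact w x) >]].

Definition is_node (x : 'I_p.+2 * {set 'I_n}) : bool :=
  (0 < x.1) && (x.2 \in Ppart x.1).
Definition node := {x : 'I_p.+2 * {set 'I_n} | is_node x}.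

Definition level (v : node) : nat := (val v).1.
Definition part (v : node) : {set 'I_n} := (val v).2.
Definition rank (v : node) : nat := #|part v|.
Definition is_root (v : node) : bool := level v == p.+1.

Definition is_parent (v u : node) : bool :=
  (level u == (level v).+1) && (part v \subset part u).
(* the parent map (the root is sent to itself; never used) *)
Definition parent (v : node) : node :=
  if [pick u | is_parent v u] is Some u then u else v.

Definition desc (c : node) : {set node} :=
  [set v | [exists k : 'I_p.+2, iter k parent v == c]].
Definition children (c : node) : {set node} :=
  [set v | (v != c) && (parent v == c)].

(* Aut of the ranked subtree rooted at c (its node set is desc c);
   bijections of desc c are encoded as permutations of the node type
   supported on desc c.  For c the root this is Aut(T, r). *)
Definition AutSub (c : node) : {set {perm node}} :=
  [set g : {perm node} | [&& perm_on (desc c) g, g c == c,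
     [forall v in desc c, (v != c) ==> (parent (g v) == g (parent v))] &
     [forall v in desc c, rank (g v) == rank v]]].

Definition sub_iso (c d : node) : bool :=
  [exists f : {ffun node -> node}, [&& f c == d,
     [forall u in desc c, forall v in desc c, (f u == f v) ==> (u == v)],
     [set f v | v in desc c] == desc d,
     [forall v in desc c, (v != c) ==> (parent (f v) == f (parent v))] &
     [forall v in desc c, rank (f v) == rank v]]].

(* isomorphism classes of the maximal proper subtrees of the subtree
   rooted at c: each class S corresponds to some t in \tilde T, with
   n(t) = #|S|, and (rep c S) is a representative child *)
Definition classes (c : node) : {set {set node}} :=
  [set [set d in children c | sub_iso e d] | e in children c].
Definition rep (c : node) (S : {set node}) : node :=
  odflt c [pick x in S].

(* \tilde Aut, by recursion on the height h of the subtree; a node at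
   level l has height l - 1 (all leaves are at level 1).  *)
Fixpoint AtT (h : nat) : finGroupType :=
  match h with
  | 0 => {perm 'I_n}
  | h'.+1 => prodT {set node} (wreathT node (AtT h'))
  end.

Fixpoint Atil (h : nat) (c : node) : {set AtT h} :=
  match h return {set AtT h} with
  | 0 =>
      [set s : {perm 'I_n} | perm_on [set i : 'I_n | i < rank c] s]
  | h'.+1 =>
      prod_on (mem (classes c))
        (fun S => wr_on S (Atil h' (rep c S)))
  end.

Definition AutRec (c : node) : {set prodT {set node} (wreathT node {perm node})} :=
  prod_on (mem (classes c)) (fun S => wr_on S (AutSub (rep c S))).

End Fission.

(* Main.v *)
Require Import Defs.
From HB Require Import structures.
From mathcomp Require Import all_boot all_order all_algebra all_fingroup.
From mathcomp Require Import boolp reals complex.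
Set Implicit Arguments.
Unset Strict Implicit.
Unset Printing Implicit Defensive.

(** Both groups obey the same recursion.  Suppose a group of permutations of a
    set consists of all permutations that permute disjoint blocks through given
    local isomorphisms.  Fixing an isomorphism from a representative to each
    block of its isomorphism class identifies the group with the product, over
    the classes, of wreath products of symmetric groups with the automorphism
    groups of the representatives.  For [Aut(T, r)] the blocks are the maximal
    proper subtrees.  For the stabilizer, [U_l] contains a vector separating the
    parts of [P_l], so the stabilizer consists of the permutations of the points
    preserving every [P_l]; its blocks are the parts of the children of the root,
    and two of them are isomorphic exactly when the corresponding subtrees are,
    because a tree isomorphism lifts to the points by matching leaves of equal
    rank. *)

(** * Isomorphisms between subsets of groups *)

(** Lets permutations of a whole finite type stand for partial bijections. By induction on [#|A|]: a
    permutation agreeing with [f] off one point [a] is corrected at [a] by a transposition, which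
    fixes the other values by injectivity. *)
Lemma perm_extend (X : finType) (A : {set X}) (f : X -> X) :
  {in A &, injective f} -> exists g : {perm X}, {in A, g =1 f}.
Proof.
have [m] := ubnP #|A|; elim: m A => // m IH A lemA injf.
have [->|[a aA]] := set_0Vmem A; first by exists 1%g => x; rewrite inE.
have [||g gf] := IH (A :\ a).
- by rewrite -ltnS; rewrite (cardsD1 a A) aA add1n in lemA.
- by move=> x y /setD1P[_ xA] /setD1P[_ yA]; apply: injf.
exists (g * tperm (g a) (f a))%g => x xA; rewrite permM.
have [->|xa] := eqVneq x a; first by rewrite tpermL.
have gx : g x = f x by apply: gf; rewrite !inE xa.
by rewrite tpermD // 1?eq_sym ?(inj_eq perm_inj) // gx; apply: contra xa => /eqP/injf->.
Qed.

Lemma perm_imset_card (X : finType) (A B : {set X}) :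
  #|A| = #|B| -> exists g : {perm X}, g @: A = B.
Proof.
move=> eqAB; pose f x := nth x (enum B) (index x (enum A)).
have idx x : x \in A -> index x (enum A) < size (enum B).
  by move=> xA; rewrite -cardE -eqAB cardE index_mem mem_enum.
have [x y xA yA|g gf] := @perm_extend _ A f.
  rewrite /f (set_nth_default y) ?idx // => /eqP.
  rewrite nth_uniq ?enum_uniq ?idx // => /eqP e.
  by rewrite -(nth_index x (s := enum A) (x := x)) ?mem_enum // e nth_index ?mem_enum.
exists g; apply/eqP; rewrite eqEcard card_imset ?eqAB ?leqnn ?andbT; last exact: perm_inj.
apply/subsetP=> _ /imsetP[x xA ->]; rewrite gf // -mem_enum; exact/mem_nth/idx.
Qed.

(** Carrying the inverse explicitly lets isomorphisms between mere subsets be built coordinate by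
    coordinate, without declaring group structures. *)
Definition giso (aT rT : finGroupType) (A : {set aT}) (B : {set rT}) : Prop :=
  exists f f', [/\ {in A, forall x, f x \in B}, {in B, forall y, f' y \in A},
    {in A, cancel f f'}, {in B, cancel f' f} &
    {in A &, {morph f : x y / (x * y)%g}}].

Definition mul_closed (aT : finGroupType) (A : {set aT}) :=
  {in A &, forall x y, (x * y)%g \in A}.

Lemma giso_inj_surj (aT rT : finGroupType) (A : {set aT}) (B : {set rT}) f :
    {in A, forall x, f x \in B} -> {in A &, {morph f : x y / (x * y)%g}} ->
    {in A &, injective f} -> {in B, forall y, exists2 x, x \in A & f x = y} ->
  giso A B.
Proof.
move=> fB fM finj fsurj.
pose f' y := odflt 1%g [pick x in A | f x == y].
have f'P y : y \in B -> f' y \in A /\ f (f' y) = y.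
  move=> yB; rewrite /f'; case: pickP => [x /andP[xA /eqP fx]|no] //=.
  by have [x xA fx] := fsurj y yB; have := no x; rewrite xA fx eqxx.
exists f, f'; split=> //.
- by move=> y /f'P[].
- by move=> x xA; have [? ?] := f'P _ (fB x xA); apply: finj.
- by move=> y /f'P[].
Qed.

(** The morphism law for the inverse cancels [f'] against [f] at a product of two elements of [A],
    so that product must lie in [A]. *)
Lemma giso_sym (aT rT : finGroupType) (A : {set aT}) (B : {set rT}) :
  mul_closed A -> giso A B -> giso B A.
Proof.
move=> Am [f [f' [fB f'A fK f'K fM]]]; exists f', f; split=> // x y xB yB.
by rewrite -{1}(f'K x) // -{1}(f'K y) // -fM ?f'A // fK ?Am ?f'A.
Qed.

Lemma giso_trans (aT bT cT : finGroupType) (A : {set aT}) (B : {set bT})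
    (C : {set cT}) : giso A B -> giso B C -> giso A C.
Proof.
move=> [f [f' [fB f'A fK f'K fM]]] [g [g' [gC g'B gK g'K gM]]].
exists (g \o f), (f' \o g'); split=> /=.
- by move=> x xA; apply/gC/fB.
- by move=> x xA; apply/f'A/g'B.
- by move=> x xA /=; rewrite gK ?fB ?fK.
- by move=> x xA /=; rewrite f'K ?g'B ?g'K.
- by move=> x y xA yA; rewrite /= fM // gM ?fB.
Qed.

Lemma giso_isog (aT rT : finGroupType) (A : {set aT}) (B : {set rT}) :
  1%g \in A -> giso A B -> A \isog B.
Proof.
move=> A1 [f [f' [fB f'A fK f'K fM]]].
have f1 : f 1%g = 1%g.
  by apply: (mulgI (f 1%g)); rewrite -fM // !mulg1.
apply/existsP; exists (finfun f); apply/andP; split.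
  by apply/forall_inP=> -[x y] /[!inE] /andP[/= xA yA]; rewrite !ffunE fM.
(* [isog] compares the sets with the identity removed, so nontrivial elements must correspond in
   both directions. *)
apply/eqP/setP=> y; apply/imsetP/setD1P => [[x /setD1P[x1 xA] ->]|[y1 yB]].
  rewrite ffunE fB //; split=> //; apply: contra x1 => /eqP fx.
  by rewrite -(fK x) // fx -f1 fK.
exists (f' y); last by rewrite ffunE f'K.
rewrite !inE f'A // andbT; apply: contra y1 => /eqP e.
by rewrite -(f'K y) // e f1.
Qed.

(** * Wreath products and direct products respect isomorphisms of their factors *)

Section Congruence.
Variables (aT bT : finGroupType).

Lemma giso_wr_on (I : finType) (S : {set I}) (G : {set aT}) (H : {set bT}) :
  giso G H -> giso (wr_on S G) (wr_on S H).
Proof.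
move=> [f [f' [fB f'A fK f'K fM]]].
(* Coordinates off [S] are reset to 1; inside [wr_on] they are trivial already, so both
   cancellations survive. *)
pose F (u : wreathT I aT) : wreathT I bT :=
  (u.1, [ffun i => if i \in S then f (u.2 i) else 1%g]).
pose F' (u : wreathT I bT) : wreathT I aT :=
  (u.1, [ffun i => if i \in S then f' (u.2 i) else 1%g]).
exists F, F'; split.
- move=> u /[!inE] /andP[-> /forallP uG] /=; apply/forallP=> i.
  by rewrite ffunE; move: (uG i); case: ifP => [_|_ _]; [exact: fB|exact: set11].
- move=> u /[!inE] /andP[-> /forallP uG] /=; apply/forallP=> i.
  by rewrite ffunE; move: (uG i); case: ifP => [_|_ _]; [exact: f'A|exact: set11].
- move=> [s x] /[!inE] /andP[_ /forallP uG]; congr (_, _); apply/ffunP=> i.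
  rewrite !ffunE /=; move: (uG i) => /=; case: ifP => // _; first exact: fK.
  by move/set1P.
- move=> [s x] /[!inE] /andP[_ /forallP uG]; congr (_, _); apply/ffunP=> i.
  rewrite !ffunE /=; move: (uG i) => /=; case: ifP => // _; first exact: f'K.
  by move/set1P.
- move=> [s x] [t y] /[!inE] /andP[/= son /forallP uG] /andP[/= _ /forallP vG].
  congr (_, _); apply/ffunP=> i; rewrite !ffunE /= ?ffunE (perm_closed _ son).
  case: ifP => [iS|_]; last by rewrite mulg1.
  move: (uG i) (vG (s i)) => /=; rewrite (perm_closed _ son) iS; exact: fM.
Qed.

Lemma giso_prod_on (K : finType) (Q : {pred K}) (F : K -> {set aT})
    (H : K -> {set bT}) :
  (forall k, k \in Q -> giso (F k) (H k)) -> giso (prod_on Q F) (prod_on Q H).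
Proof.
move=> FH.
have /choice[f /choice[f' fP]] : forall k, exists f f', k \in Q ->
    [/\ {in F k, forall x, f x \in H k}, {in H k, forall y, f' y \in F k},
      {in F k, cancel f f'}, {in H k, cancel f' f} &
      {in F k &, {morph f : x y / (x * y)%g}}].
  (* Constant functions outside [Q] make the choice total. *)
  move=> k; case: (boolP (k \in Q)) => [/FH[f [f' ?]]|]; first by exists f, f'.
  by exists (fun=> 1%g), (fun=> 1%g).
pose G (u : prodT K aT) : prodT K bT :=
  [ffun k => if k \in Q then f k (u k) else 1%g].
pose G' (u : prodT K bT) : prodT K aT :=
  [ffun k => if k \in Q then f' k (u k) else 1%g].
exists G, G'; split.
- move=> u /[!inE] /forallP uG; apply/forallP=> k; rewrite ffunE.
  by move: (uG k); case: ifP => [/fP[fB _ _ _ _]|_ _]; [exact: fB|exact: set11].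
- move=> u /[!inE] /forallP uG; apply/forallP=> k; rewrite ffunE.
  by move: (uG k); case: ifP => [/fP[_ fB _ _ _]|_ _]; [exact: fB|exact: set11].
- move=> u /[!inE] /forallP uG; apply/ffunP=> k; rewrite !ffunE.
  by move: (uG k); case: ifP => [/fP[_ _ fK _ _]|_]; [exact: fK|move/set1P].
- move=> u /[!inE] /forallP uG; apply/ffunP=> k; rewrite !ffunE.
  by move: (uG k); case: ifP => [/fP[_ _ _ fK _]|_]; [exact: fK|move/set1P].
- move=> u v /[!inE] /forallP uG /forallP vG; apply/ffunP=> k; rewrite !ffunE.
  move: (uG k) (vG k); case: ifP => [/fP[_ _ _ _ fM]|_ _ _]; first exact: fM.
  by rewrite mulg1.
Qed.

End Congruence.

Lemma mul_closed_wr_on (I : finType) (gT : finGroupType) (S : {set I})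
  (G : {set gT}) : mul_closed G -> mul_closed (wr_on S G).
Proof.
move=> Gm [s x] [t y] /[!inE] /andP[/= son /forallP uG] /andP[/= ton /forallP vG].
rewrite perm_onM //; apply/forallP=> i; rewrite ffunE.
move: (uG i) (vG (s i)) => /=; rewrite (perm_closed _ son).
by case: ifP => _; [exact: Gm|move=> /set1P-> /set1P->; rewrite mulg1 set11].
Qed.

Lemma mul_closed_prod_on (K : finType) (gT : finGroupType) (Q : {pred K})
    (F : K -> {set gT}) :
  (forall k, k \in Q -> mul_closed (F k)) -> mul_closed (prod_on Q F).
Proof.
move=> Fm u v /[!inE] /forallP uF /forallP vF; apply/forallP=> k; rewrite ffunE.
move: (uF k) (vF k); case: ifP => [/Fm|_]; first by move=> h *; exact: h.
by move=> /set1P-> /set1P->; rewrite mulg1 set11.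
Qed.

(** * Permutations of disjoint blocks *)

Section BlockPermutations.
Variables (X K : finType) (D : {set K}) (B : K -> {set X}).
(** [iso d e g] says that [g] restricts to a local isomorphism from block [d] to block [e]. The
    section is applied twice: to nodes, with blocks [desc d], and to points, with blocks
    [part d]. *)
Variables (iso : K -> K -> {perm X} -> Prop) (sim : rel K).
Variables (G : {set {perm X}}) (AutB : K -> {set {perm X}}) (repr : {set K} -> K).

Hypothesis B_neq0 : forall d, d \in D -> exists x, x \in B d.
Hypothesis B_inj : forall d e x, d \in D -> e \in D -> x \in B d -> x \in B e -> d = e.
Hypothesis iso_im : forall d e g, iso d e g -> g @: B d = B e.
Hypothesis iso_ext : forall d e (g h : {perm X}),
  d \in D -> {in B d, g =1 h} -> iso d e g -> iso d e h.
Hypothesis iso1 : forall d, iso d d 1%g.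
Hypothesis isoM : forall d e f g h, iso d e g -> iso e f h -> iso d f (g * h)%g.
Hypothesis isoV : forall d e g, iso d e g -> iso e d g^-1%g.
Hypothesis simP : forall d e, d \in D -> e \in D -> sim d e <-> exists g, iso d e g.
Hypothesis GP : forall g, g \in G <->
  perm_on (\bigcup_(d in D) B d) g /\
  forall d, d \in D -> exists2 e, e \in D & iso d e g.
Hypothesis AutP : forall d g, d \in D ->
  g \in AutB d <-> perm_on (B d) g /\ iso d d g.
Hypothesis reprP : forall S, S != set0 -> repr S \in S.

Let cls d := [set e in D | sim d e].
Let Q := [set cls d | d in D].
Let r d := repr (cls d).

Let isoP d e g : iso d e g -> forall x, (g x \in B e) = (x \in B d).
Proof. by move=> /iso_im <- x; rewrite mem_imset //; exact: perm_inj. Qed.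

Let cls_refl d : d \in D -> d \in cls d.
Proof. by move=> dD; rewrite inE dD; apply/simP => //; exists 1%g. Qed.

Let cls_eq d e : d \in D -> e \in cls d -> cls e = cls d.
Proof.
move=> dD /[!inE] /andP[eD /simP[]// g gi]; apply/setP=> f; rewrite !inE.
case: (boolP (f \in D)) => //= fD; apply/idP/idP => /simP[]// h hi; apply/simP => //.
  by exists (g * h)%g; exact: isoM hi.
by exists (g^-1 * h)%g; apply: isoM hi; exact: isoV.
Qed.

Let r_cls d : d \in D -> r d \in cls d.
Proof. by move=> dD; apply/reprP/set0Pn; exists d; exact: cls_refl. Qed.

Let r_D d : d \in D -> r d \in D.
Proof. by move/r_cls; rewrite inE => /andP[]. Qed.

Let transport : exists tau : K -> {perm X}, forall d, d \in D -> iso (r d) d (tau d).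
Proof.
suff /choice[tau tauP] : forall d, exists t, d \in D -> iso (r d) d t by exists tau.
move=> d; case: (boolP (d \in D)) => [dD|_]; last by exists 1%g.
have /[!inE]/andP[rD /simP[]// g /isoV gi] := r_cls dD.
by exists g^-1%g => _.
Qed.

Let cls_Q S d : S \in Q -> d \in S -> d \in D /\ S = cls d.
Proof.
move=> /imsetP[e eD ->] de; rewrite (cls_eq eD de); split=> //.
by move: de; rewrite inE => /andP[].
Qed.

Let block x := [pick d in D | x \in B d].

Let blockE d x : d \in D -> x \in B d -> block x = Some d.
Proof.
move=> dD xd; rewrite /block; case: pickP => [e /andP[eD xe]|/(_ d)].
  by rewrite (B_inj dD eD xd xe).
by rewrite dD xd.
Qed.

Let prodG := prod_on (mem Q) (fun S => wr_on S (AutB (repr S))).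

Let coordP u d : u \in prodG -> d \in D ->
  [/\ (u (cls d)).1 d \in D, cls ((u (cls d)).1 d) = cls d
    & (u (cls d)).2 d \in AutB (r d)].
Proof.
move=> /[!inE] /forallP /(_ (cls d)) + dD.
rewrite /= imset_f //= inE => /andP[on /forallP /(_ d)].
rewrite cls_refl // => uA; have : (u (cls d)).1 d \in cls d.
  by rewrite (perm_closed _ on) cls_refl.
by move=> h; rewrite (cls_eq dD h); split=> //; move: h; rewrite inE => /andP[].
Qed.

Let mul_closed_AutB d : d \in D -> mul_closed (AutB d).
Proof.
move=> dD g h /(AutP _ dD)[gon gi] /(AutP _ dD)[hon hi]; apply/(AutP _ dD).
by split; [exact: perm_onM|exact: isoM hi].
Qed.

(** * The isomorphism from the product of wreath products to [G] *)

Section Psi.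
Variable tau : K -> {perm X}.
Hypothesis tauP : forall d, d \in D -> iso (r d) d (tau d).

(** Products of permutations act left to right: go back from block [d] to its representative, apply
    the coordinate of [u] at [d], then move out to the block that [u] assigns to [d]. *)
Let psi_on (u : prodT {set K} (wreathT K {perm X})) d : {perm X} :=
  ((tau d)^-1 * (u (cls d)).2 d * tau ((u (cls d)).1 d))%g.

Let psi_fun u x := if block x is Some d then psi_on u d x else x.

Let psi_funE u d x : d \in D -> x \in B d -> psi_fun u x = psi_on u d x.
Proof. by move=> dD xd; rewrite /psi_fun (blockE dD xd). Qed.

Let psi_iso u d : u \in prodG -> d \in D -> iso d ((u (cls d)).1 d) (psi_on u d).
Proof.
move=> uG dD; have [eD ce /AutP] := coordP uG dD.
rewrite r_D // => -[]// _ ai; apply: isoM (tauP eD); rewrite /r ce.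
by apply: isoM ai; apply/isoV/tauP.
Qed.

(** Each block stays in its class, so equal targets force equal classes, and within one class a
    single permutation acts. *)
Let u1_inj u d e : u \in prodG -> d \in D -> e \in D ->
  (u (cls d)).1 d = (u (cls e)).1 e -> d = e.
Proof.
move=> uG dD eD eq1; have [_ cd _] := coordP uG dD; have [_ ce _] := coordP uG eD.
have cde : cls d = cls e by rewrite -cd eq1 ce.
by move: eq1; rewrite cde; exact: perm_inj.
Qed.

Let psi_fun_inj u : u \in prodG -> injective (psi_fun u).
Proof.
move=> uG x y.
(* Points outside all blocks are fixed, and those of block [d] land in its target block. A collision
   therefore happens inside one block, where [psi_on] is a permutation. *)
have out z : (forall d, d \in D -> z \notin B d) -> psi_fun u z = z.
  move=> zn; rewrite /psi_fun /block; case: pickP => // d /andP[dD zd].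
  by have := zn d dD; rewrite zd.
have inn z d : d \in D -> z \in B d ->
    [/\ psi_fun u z = psi_on u d z, (u (cls d)).1 d \in D
      & psi_fun u z \in B ((u (cls d)).1 d)].
  move=> dD zd; rewrite (psi_funE u dD zd) (isoP (psi_iso uG dD)).
  by have [] := coordP uG dD.
have dec z : (exists2 d, d \in D & z \in B d) \/ (forall d, d \in D -> z \notin B d).
  case: (boolP [exists d in D, z \in B d]) => [/exists_inP|/exists_inPn]; first by left.
  by right.
case: (dec x) => [[d dD xd]|xn]; case: (dec y) => [[e eD ye]|yn].
- have [ex uD xu] := inn _ _ dD xd; have [ey vD yv] := inn _ _ eD ye.
  move=> exy; rewrite -exy in yv; have de := u1_inj uG dD eD (B_inj uD vD xu yv).
  by move: exy; rewrite ex ey de; exact: perm_inj.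
- have [_ uD xu] := inn _ _ dD xd; rewrite (out y) // => exy.
  by rewrite exy in xu; have := yn _ uD; rewrite xu.
- have [_ uD xu] := inn _ _ eD ye; rewrite (out x) // => exy.
  by rewrite -exy in xu; have := xn _ uD; rewrite xu.
- by rewrite !out.
Qed.

(** [psi_fun u] is known to be injective only for [u] in [prodG]; picking a permutation keeps [psi]
    total. *)
Let psi u : {perm X} := odflt 1%g [pick g : {perm X} | [forall x, g x == psi_fun u x]].

Let psiE u : u \in prodG -> psi u =1 psi_fun u.
Proof.
move=> uG x; rewrite /psi; case: pickP => [g /forallP/(_ x)/eqP//|].
move/(_ (perm (psi_fun_inj uG)))/negP; case; apply/forallP=> y.
by rewrite permE.
Qed.

Let psi_B u d x : u \in prodG -> d \in D -> x \in B d -> psi u x = psi_on u d x.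
Proof. by move=> uG dD xd; rewrite psiE ?(psi_funE u dD). Qed.

Let psi_isoB u d : u \in prodG -> d \in D -> iso d ((u (cls d)).1 d) (psi u).
Proof.
move=> uG dD; apply: iso_ext (psi_iso uG dD) => // x xd.
by rewrite (psi_B uG dD xd).
Qed.

Let psi_on_cup u : u \in prodG -> perm_on (\bigcup_(d in D) B d) (psi u).
Proof.
move=> uG; apply/subsetP=> x; apply: contraR => /bigcupP xn.
rewrite psiE // /psi_fun /block; case: pickP => // d /andP[dD xd].
by case: xn; exists d.
Qed.

Let psi_G u : u \in prodG -> psi u \in G.
Proof.
move=> uG; apply/GP; split=> [|d dD]; first exact: psi_on_cup.
by exists ((u (cls d)).1 d); [have [] := coordP uG dD|exact: psi_isoB].
Qed.

Let prodG_mul : mul_closed prodG.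
Proof.
apply: mul_closed_prod_on => S /imsetP[d dD ->].
exact/mul_closed_wr_on/mul_closed_AutB/r_D.
Qed.

Let psiM : {in prodG &, {morph psi : u v / (u * v)%g}}.
Proof.
move=> u v uG vG; have uvG := prodG_mul uG vG.
apply/permP=> x; rewrite permM.
case: (boolP (x \in \bigcup_(d in D) B d)) => [/bigcupP[d dD xd]|xn]; last first.
  by rewrite !(out_perm (psi_on_cup _) xn).
(* The second factor starts in the target block of [d], which has the same class; its inverse
   transport cancels the last transport of the first factor, leaving the multiplication rule of the
   wreath product. *)
have [eD ce _] := coordP uG dD.
have ux : psi u x \in B ((u (cls d)).1 d) by rewrite (isoP (psi_isoB uG dD)).
rewrite (psi_B uvG dD xd) (psi_B vG eD ux) (psi_B uG dD xd) /psi_on ce.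
by rewrite !ffunE /= ?ffunE /= !permM permK.
Qed.

Let psi_inj : {in prodG &, injective psi}.
Proof.
move=> u v uG vG euv; apply/ffunP=> S.
move: (uG) (vG); rewrite !inE => /forallP/(_ S) uS /forallP/(_ S) vS.
move: uS vS; case: ifP => [SQ|_ /set1P-> /set1P->//].
rewrite !inE => /andP[uon /forallP uA] /andP[von /forallP vA].
(* The target of a nonempty block is read off from the image of any of its points. *)
have e1 d : d \in S -> (u S).1 d = (v S).1 d.
  move=> dS; have [dD eS] := cls_Q SQ dS; rewrite eS.
  have [x xd] := B_neq0 dD.
  have [uD _ _] := coordP uG dD; have [vD _ _] := coordP vG dD.
  apply: (B_inj (x := psi u x) uD vD); first by rewrite (isoP (psi_isoB uG dD)).
  by rewrite euv (isoP (psi_isoB vG dD)).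
have e2 : (u S).1 = (v S).1.
  apply/permP=> d; case: (boolP (d \in S)) => [|dS]; first exact: e1.
  by rewrite (out_perm uon dS) (out_perm von dS).
suff e3 : (u S).2 = (v S).2 by rewrite (surjective_pairing (u S)) e2 e3 -surjective_pairing.
apply/ffunP=> d; move: (uA d) (vA d); case: ifP => [dS|_ /set1P-> /set1P->//].
have [dD eS] := cls_Q SQ dS.
have rD : repr S \in D by rewrite eS; exact: r_D.
move=> /(AutP _ rD)[ud _] /(AutP _ rD)[vd _]; apply/permP=> x.
case: (boolP (x \in B (repr S))) => [xr|xr]; last first.
  by rewrite (out_perm ud xr) (out_perm vd xr).
(* Evaluating at the transported point cancels the transports on both sides and leaves the two
   coordinates at [x]. *)
have tx : tau d x \in B d by rewrite (isoP (tauP dD)) /r -eS.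
have := psi_B uG dD tx; rewrite euv (psi_B vG dD tx) /psi_on -eS e2 !permM permK.
by move/perm_inj.
Qed.

Let psi_surj : {in G, forall g, exists2 u, u \in prodG & psi u = g}.
Proof.
move=> g /GP[gon gi].
have /choice[s sP] : forall d, exists e, d \in D -> e \in D /\ iso d e g.
  move=> d; case: (boolP (d \in D)) => [/gi[e]|_]; first by exists e.
  by exists d.
have sD d : d \in D -> s d \in D by move/sP=> [].
have si d : d \in D -> iso d (s d) g by move/sP=> [].
have s_inj : {in D &, injective s}.
  move=> d e dD eD sde; have [x xd] := B_neq0 dD.
  apply: (B_inj dD eD xd); rewrite -(isoP (si e eD)) -sde.
  by rewrite (isoP (si d dD)).
have [sg sgE] := perm_extend s_inj.
have s_cls d : d \in D -> s d \in cls d.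
  by move=> dD; rewrite inE sD //=; apply/simP; rewrite ?sD //; exists g; exact: si.
(* [restr_perm] is the true restriction only for permutations stabilizing the set; [aN] below serves
   the same purpose. *)
have sgN S : S \in Q -> sg \in ('N(S | 'P))%g.
  move=> SQ; rewrite !inE; apply/subsetP=> d dS; rewrite inE /= /aperm.
  have [dD ->] := cls_Q SQ dS; rewrite sgE //; exact: s_cls.
(* Obtained by solving the formula of [psi_on] for the coordinate at [d], with [g] in place of the
   result. *)
pose a d := (tau d * g * (tau (s d))^-1)%g.
have ai d : d \in D -> iso (r d) (r d) (a d).
  move=> dD; apply: isoM (isoM (tauP dD) (si d dD)) _.
  have -> : r d = r (s d) by rewrite /r (cls_eq dD (s_cls d dD)).
  exact/isoV/tauP/sD.
have aN d : d \in D -> a d \in ('N(B (r d) | 'P))%g.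
  move=> dD; rewrite !inE; apply/subsetP=> x xd; rewrite inE /= /aperm.
  by rewrite (isoP (ai d dD)).
pose u : prodT {set K} (wreathT K {perm X}) :=
  [ffun S => if S \in Q then
     (restr_perm S sg, [ffun d => if d \in S then restr_perm (B (r d)) (a d) else 1%g])
   else 1%g].
have uG : u \in prodG.
  rewrite inE; apply/forallP=> S; rewrite ffunE.
  case: ifP => [SQ|_]; last exact: set11.
  rewrite inE /= restr_perm_on; apply/forallP=> d; rewrite ffunE.
  case: ifP => [dS|_]; last exact: set11.
  have [dD eS] := cls_Q SQ dS; rewrite eS; apply/(AutP _ (r_D dD)).
  split; first exact: restr_perm_on.
  by apply: iso_ext (ai d dD) => [|x xr]; [exact: r_D|rewrite restr_permE ?aN].
exists u => //; apply/permP=> x.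
case: (boolP (x \in \bigcup_(d in D) B d)) => [/bigcupP[d dD xd]|xn]; last first.
  by rewrite (out_perm (psi_on_cup uG) xn) (out_perm gon xn).
have dQ : cls d \in Q by apply: imset_f.
rewrite (psi_B uG dD xd) /psi_on ffunE dQ /= ffunE cls_refl //.
rewrite restr_permE ?sgN ?cls_refl // sgE // !permM restr_permE ?aN //; last first.
  by rewrite -(isoP (tauP dD)) permKV.
by rewrite /a !permM permKV permKV.
Qed.

Let giso_psi : giso prodG G.
Proof. exact: giso_inj_surj psi_G psiM psi_inj psi_surj. Qed.

Lemma giso_blocks_aux : giso G prodG.
Proof. exact: giso_sym prodG_mul giso_psi. Qed.

End Psi.

Lemma giso_block_perms :
  giso G (prod_on (mem [set [set e in D | sim d e] | d in D])
            (fun S => wr_on S (AutB (repr S)))).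
Proof. by have [tau tauP] := transport; exact: giso_blocks_aux tauP. Qed.

End BlockPermutations.

(** * The fission tree and its automorphisms *)

Section FissionTree.
Variables (R : realType) (n p : nat) (A : 'I_p -> 'I_n -> R[i]).
Implicit Types (u v c d e : node A) (a b : 'I_n) (l : nat).

(** * The equivalence relations of the levels, and nodes as their classes *)

Lemma same_refl l a : same A l a a.
Proof. by apply/forallP=> j; rewrite eqxx implybT. Qed.

Lemma same_sym l a b : same A l a b = same A l b a.
Proof. by apply: eq_forallb => j; rewrite [A j a == _]eq_sym. Qed.

Lemma same_trans l b a a' : same A l a b -> same A l b a' -> same A l a a'.
Proof.
move=> /forallP ab /forallP bc; apply/forallP=> j; apply/implyP=> lj.
by move: (ab j) (bc j); rewrite lj => /eqP-> /eqP->.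
Qed.

Lemma same_mono l l' a b : l <= l' -> same A l a b -> same A l' a b.
Proof.
move=> ll' /forallP ab; apply/forallP=> j; apply/implyP=> lj.
exact: implyP (ab j) (leq_trans ll' lj).
Qed.

Lemma same_top l a b : p < l -> same A l a b.
Proof.
move=> pl; apply/forallP=> j; apply/implyP=> lj.
by have := leq_trans (leq_trans pl lj) (ltn_ord j); rewrite ltnn.
Qed.

(** Indices enter as [j.+1], which is never 0, so level 0 imposes the same conditions as level 1. *)
Lemma same0 a b : same A 0 a b = same A 1 a b.
Proof. exact: eq_forallb. Qed.

Lemma level_bounds v : 0 < level v <= p.+1.
Proof. by have /andP[-> _] := valP v; rewrite -ltnS ltn_ord. Qed.

Lemma part_neq0 v : exists a, a \in part v.
Proof.
have /andP[_ /imsetP[a _ e]] := valP v.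
by exists a; rewrite /part e inE same_refl.
Qed.

Lemma mem_part v a b : a \in part v -> (b \in part v) = same A (level v) a b.
Proof.
have /andP[_ /imsetP[a0 _ e]] := valP v.
rewrite /part e !inE -/(level v) => a0a; apply/idP/idP.
  by apply: same_trans; rewrite same_sym.
exact: same_trans.
Qed.

Lemma node_eq u v a : level u = level v -> a \in part u -> a \in part v -> u = v.
Proof.
move=> luv au av; apply: val_inj; rewrite (surjective_pairing (val u)).
rewrite [RHS]surjective_pairing; congr (_, _); first exact: val_inj.
by apply/setP=> b; rewrite -/(part u) -/(part v) (mem_part _ au) (mem_part _ av) luv.
Qed.

Lemma node_at l a : 0 < l <= p.+1 -> exists2 v : node A, level v = l & a \in part v.
Proof.
case/andP=> l0 lp; pose x : 'I_p.+2 * {set 'I_n} := (inord l, [set b | same A l a b]).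
have xn : is_node A x.
  by rewrite /is_node /= inordK ?ltnS // l0 /=; apply: imset_f.
exists (Sub x xn : node A); rewrite /level /part SubK /= ?inordK ?ltnS //.
by rewrite inE same_refl.
Qed.

Lemma part_sub u v a :
  level u <= level v -> a \in part u -> a \in part v -> part u \subset part v.
Proof.
move=> luv au av; apply/subsetP=> b; rewrite (mem_part _ au) (mem_part _ av).
exact: same_mono.
Qed.

(** * Parents, descendants and children *)

Lemma parent_lt v : level v <= p ->
  level (parent v) = (level v).+1 /\ part v \subset part (parent v).
Proof.
move=> lv; rewrite /parent; case: pickP => [u /andP[/eqP-> ->]//|no].
have [a av] := part_neq0 v; have [|u lu au] := @node_at (level v).+1 a.
  by rewrite ltnS.
by have := no u; rewrite /is_parent lu eqxx (part_sub (a := a)) ?lu.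
Qed.

Lemma parent_top v : level v = p.+1 -> parent v = v.
Proof.
move=> lv; rewrite /parent; case: pickP => // u /andP[/eqP lu _].
by have /andP[_] := level_bounds u; rewrite lu lv ltnn.
Qed.

Lemma level_case v : level v = p.+1 \/ level v <= p.
Proof.
have /andP[_] := level_bounds v; rewrite leq_eqVlt ltnS => /orP[/eqP|]; first by left.
by right.
Qed.

Lemma parent_ge v : level v <= level (parent v) /\ part v \subset part (parent v).
Proof.
case: (level_case v) => [/parent_top->|/parent_lt[-> ?]]; first by [].
by rewrite leqnSn.
Qed.

(** The minimum appears because the root is its own parent. *)
Lemma iter_parent k v :
  level (iter k (@parent _ _ _ A) v) = minn (level v + k) p.+1 /\
  part v \subset part (iter k (@parent _ _ _ A) v).
Proof.
elim: k => [|k [lk sk]] /=.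
  by rewrite addn0; have /andP[_ /minn_idPl ->] := level_bounds v.
set w := iter k _ v in lk sk *; have [_ sw] := parent_ge w.
split; last exact: subset_trans sw.
case: (level_case w) => lw.
  rewrite parent_top // lw; apply/esym/minn_idPr.
  by rewrite addnS; move: lk; rewrite lw => /esym/minn_idPr/leqW.
have [-> _] := parent_lt lw; move: lk lw; rewrite addnS.
rewrite /minn; case: (ltnP (level v + k)) => [h -> hp|_ ->]; last by rewrite ltnn.
by rewrite ltnS; case: (ltnP (level v + k)) => //; move: hp; case: ltngtP => // ->.
Qed.

(** Replaces iterated parents by an order on nodes; the number of steps is the difference of levels.
    Levels must be compared too, since one set may be a part at several levels. *)
Lemma mem_desc v c : (v \in desc c) = (level v <= level c) && (part v \subset part c).
Proof.
rewrite inE; apply/existsP/andP => [[k /eqP <-]|[lvc svc]].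
  have [-> ->] := iter_parent k v; split=> //.
  by rewrite leq_min leq_addr; have /andP[_ ->] := level_bounds v.
have /andP[_ lc] := level_bounds c.
have kp : level c - level v < p.+2 by rewrite ltnS (leq_trans (leq_subr _ _)).
exists (Ordinal kp); apply/eqP; have [lk sk] := iter_parent (level c - level v) v.
have [a av] := part_neq0 v; apply: (node_eq (a := a)) => /=.
- by rewrite lk subnKC //; apply/minn_idPl.
- exact: subsetP sk _ av.
- exact: subsetP svc _ av.
Qed.

Lemma desc_level v c : v \in desc c -> level v <= level c.
Proof. by rewrite mem_desc => /andP[]. Qed.

Lemma desc_part v c : v \in desc c -> part v \subset part c.
Proof. by rewrite mem_desc => /andP[]. Qed.

Lemma descI v c : level v <= level c -> part v \subset part c -> v \in desc c.
Proof. by rewrite mem_desc => -> ->. Qed.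

Lemma desc_refl c : c \in desc c.
Proof. by rewrite mem_desc leqnn subxx. Qed.

Lemma mem_children v c :
  (v \in children c) = ((level v).+1 == level c) && (part v \subset part c).
Proof.
rewrite inE; apply/andP/andP => [[vc /eqP pv]|[/eqP lv sv]].
  case: (level_case v) => [/parent_top e|/parent_lt[lv sv]].
    by move: vc; rewrite -pv e eqxx.
  by rewrite -pv lv eqxx.
have /andP[_ lc] := level_bounds c; rewrite -lv ltnS in lc.
have [lw sw] := parent_lt lc; have [a av] := part_neq0 v; split.
  by apply/eqP=> vc; move/eqP: lv; rewrite vc eqn_leq ltnn.
apply/eqP/(node_eq (a := a)); first by rewrite lw.
  exact: subsetP sw _ av.
exact: subsetP sv _ av.
Qed.

Lemma children_neq d c : d \in children c -> d != c.
Proof. by rewrite inE => /andP[]. Qed.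

Lemma childrenI d c : d != c -> parent d = c -> d \in children c.
Proof. by rewrite inE => -> ->; rewrite eqxx. Qed.

Lemma parent_child d c : d \in children c -> parent d = c.
Proof. by rewrite inE => /andP[_ /eqP]. Qed.

(* Unfolding these makes unification of membership goals explode. *)
Local Opaque desc children parent.

Lemma desc_level_lt v c : v \in desc c -> v != c -> level v < level c.
Proof.
move=> vc; rewrite ltn_neqAle (desc_level vc) andbT; apply: contra => /eqP lvc.
have [a av] := part_neq0 v.
by apply/eqP/(node_eq lvc av); exact: subsetP (desc_part vc) _ av.
Qed.

Lemma desc_anti v c : v \in desc c -> c \in desc v -> v = c.
Proof.
move=> vc /desc_level lc; apply/eqP/negPn/negP => nvc.
by have := desc_level_lt vc nvc; rewrite ltnNge lc.
Qed.

Lemma desc_parent v c : v \in desc c -> v != c -> parent v \in desc c.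
Proof.
move=> vc nvc; have ltv := desc_level_lt vc nvc.
have [a av] := part_neq0 v; have ac := subsetP (desc_part vc) _ av.
have /andP[_ lc] := level_bounds c.
have [lw sw] := parent_lt (leq_trans ltv lc); rewrite -lw in ltv.
exact: descI ltv (part_sub ltv (subsetP sw _ av) ac).
Qed.

Lemma desc_of_parent v c : parent v \in desc c -> v \in desc c.
Proof.
move=> pc; have [l1 s1] := parent_ge v; apply: descI.
  exact: leq_trans l1 (desc_level pc).
exact: subset_trans s1 (desc_part pc).
Qed.

Lemma desc_trans d c v : d \in desc c -> v \in desc d -> v \in desc c.
Proof.
move=> dc vd; apply: descI; first exact: leq_trans (desc_level vd) (desc_level dc).
exact: subset_trans (desc_part vd) (desc_part dc).
Qed.

Lemma child_level d c : d \in children c -> level c = (level d).+1.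
Proof. by rewrite mem_children => /andP[/eqP->]. Qed.

Lemma child_part d c : d \in children c -> part d \subset part c.
Proof. by rewrite mem_children => /andP[]. Qed.

Lemma children_desc d c : d \in children c -> d \in desc c.
Proof.
by move=> dc; apply: descI (child_part dc); rewrite (child_level dc) leqnSn.
Qed.

Lemma child_notin_desc d c : d \in children c -> c \notin desc d.
Proof. by move/child_level=> lc; rewrite mem_desc lc ltnn. Qed.

Lemma child_at c a :
  1 < level c -> a \in part c -> exists2 d, d \in children c & a \in part d.
Proof.
move=> lc ac; have /andP[_ lcp] := level_bounds c.
have lcE : (level c).-1.+1 = level c by rewrite prednK // ltnW.
have [|d ld ad] := @node_at (level c).-1 a.
  by rewrite -ltnS lcE lc /= (leq_trans (leq_pred _)).
have ldc : level d <= level c by rewrite ld leq_pred.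
by exists d; rewrite // mem_children ld lcE eqxx (part_sub ldc ad ac).
Qed.

Lemma child_inj c d e a :
  d \in children c -> e \in children c -> a \in part d -> a \in part e -> d = e.
Proof.
move=> /child_level ld /child_level le; apply: node_eq.
by apply: succn_inj; rewrite -ld.
Qed.

Lemma child_desc_inj c d e v :
  d \in children c -> e \in children c -> v \in desc d -> v \in desc e -> d = e.
Proof.
move=> dc ec /desc_part vd /desc_part ve; have [a av] := part_neq0 v.
exact: child_inj dc ec (subsetP vd _ av) (subsetP ve _ av).
Qed.

Lemma desc_child v c :
  v \in desc c -> v != c -> exists2 d, d \in children c & v \in desc d.
Proof.
move=> vc nvc; have ltv := desc_level_lt vc nvc.
have [a av] := part_neq0 v; have ac := subsetP (desc_part vc) _ av.
have /andP[v0 _] := level_bounds v.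
have [d dc ad] := child_at (leq_ltn_trans v0 ltv) ac; exists d; first exact: dc.
have lvd : level v <= level d by rewrite -ltnS -(child_level dc).
exact: descI lvd (part_sub lvd av ad).
Qed.

(** Stated for arbitrary functions, so that it covers both permutations of the nodes and the finite
    functions in [sub_iso]. *)
Definition tree_iso d e (g : node A -> node A) : Prop :=
  [/\ g d = e, g @: desc d = desc e,
      {in desc d, forall v, v != d -> parent (g v) = g (parent v)} &
      {in desc d, forall v, rank (g v) = rank v}].

Lemma tree_iso_ext d e (g h : node A -> node A) :
  {in desc d, g =1 h} -> tree_iso d e g -> tree_iso d e h.
Proof.
move=> gh [gd gi gp gr]; split.
- by rewrite -gh ?desc_refl.
- by rewrite -gi; apply/esym/eq_in_imset.
- by move=> v vd nvd; rewrite -!gh ?gp ?desc_parent.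
- by move=> v vd; rewrite -gh ?gr.
Qed.

Lemma tree_iso1 d : tree_iso d d (1%g : {perm node A}).
Proof.
split=> [||v vd _|v vd]; rewrite ?perm1 //.
by rewrite -[RHS]imset_id; apply: eq_imset => v; rewrite perm1.
Qed.

Lemma tree_isoM d e f (g h : {perm node A}) :
  tree_iso d e g -> tree_iso e f h -> tree_iso d f (g * h)%g.
Proof.
move=> [gd gi gp gr] [hd hi hp hr].
have ge v : v \in desc d -> g v \in desc e by move=> vd; rewrite -gi imset_f.
split=> [||v vd nvd|v vd].
- by rewrite permM gd.
- by rewrite -hi -gi -imset_comp; apply: eq_imset => v; rewrite permM.
- by rewrite !permM hp ?ge // ?gp // -gd (inj_eq perm_inj).
- by rewrite permM hr ?ge ?gr.
Qed.

Lemma tree_isoV d e (g : {perm node A}) : tree_iso d e g -> tree_iso e d g^-1%g.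
Proof.
move=> [gd gi gp gr].
have gVe v : v \in desc e -> (g^-1)%g v \in desc d.
  by rewrite -gi => /imsetP[w wd ->]; rewrite permK.
split=> [||v ve nve|v ve].
- by rewrite -gd permK.
- rewrite -gi -imset_comp -[RHS]imset_id; apply: eq_imset => v /=.
  by rewrite permK.
- apply: (@perm_inj _ g); rewrite permKV -gp ?gVe ?permKV //.
  by apply: contra nve => /eqP vE; rewrite -gd -vE permKV.
- by rewrite -[in RHS](permKV g v) gr ?gVe.
Qed.

(** Climb from [v] to [d] by induction on the difference of levels: [g] commutes with each parent
    step. *)
Lemma tree_iso_image_desc c c' (g : {perm node A}) d v :
  tree_iso c c' g -> d \in desc c -> v \in desc d -> g v \in desc (g d).
Proof.
move=> [_ _ gp _] dc; have [k] := ubnP (level d - level v).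
elim: k v => [v /[!ltn0] /notF[]|k IH v lk vd].
have [->|nvd] := eqVneq v d; first exact: desc_refl.
have vc := desc_trans dc vd; have pd := desc_parent vd nvd.
have nvc : v != c.
  by apply/eqP=> vE; rewrite vE in vd nvd; rewrite (desc_anti vd dc) eqxx in nvd.
apply: desc_of_parent; rewrite (gp v vc nvc); apply: (IH _ _ pd).
have ltv : level v < level (parent v).
  have ltd := desc_level_lt vd nvd; have /andP[_ ld] := level_bounds d.
  by have [->] := parent_lt (leq_trans ltd ld).
rewrite -ltnS; apply: leq_trans lk; rewrite ltnS; apply: (ltn_sub2l _ ltv).
exact: leq_trans ltv (desc_level pd).
Qed.

Lemma tree_iso_desc c c' (g : {perm node A}) d :
  tree_iso c c' g -> d \in desc c -> tree_iso d (g d) g.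
Proof.
move=> gi dc; have [gc gim gp gr] := gi; split.
- by [].
- apply/eqP; rewrite eqEsubset; apply/andP; split; apply/subsetP=> v.
    by case/imsetP=> w wd ->; exact: tree_iso_image_desc gi dc wd.
  move=> vgd; apply/imsetP; exists ((g^-1)%g v); last by rewrite permKV.
  rewrite -(permK g d); apply: tree_iso_image_desc (tree_isoV gi) _ vgd.
  by rewrite -gim; exact: imset_f.
- move=> v vd nvd; apply: gp; first exact: desc_trans dc vd.
  by apply/eqP=> vE; rewrite vE in vd nvd; rewrite (desc_anti vd dc) eqxx in nvd.
- by move=> v vd; apply: gr; exact: desc_trans dc vd.
Qed.

Lemma AutSubP c (g : {perm node A}) :
  g \in AutSub c <-> perm_on (desc c) g /\ tree_iso c c g.
Proof.
rewrite inE; split.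
  case/and4P=> gon /eqP gc /forall_inP gp /forall_inP gr; split=> //; split=> //.
  - exact: im_perm_on.
  - by move=> v vc nvc; apply/eqP; exact: implyP (gp v vc) nvc.
  - by move=> v vc; apply/eqP/gr.
case=> gon [gc _ gp gr]; apply/and4P; split=> //; first exact/eqP.
  by apply/forall_inP=> v vc; apply/implyP=> nvc; rewrite gp.
by apply/forall_inP=> v vc; rewrite gr.
Qed.

(** An isomorphism of subtrees is injective on [desc c], so it extends to a permutation of all
    nodes. *)
Lemma sub_isoP c d : sub_iso c d <-> exists g : {perm node A}, tree_iso c d g.
Proof.
split=> [/existsP[f /and5P[/eqP fc /forall_inP finj /eqP fi /forall_inP fp]]|].
  move=> /forall_inP fr.
  have [u v uc vc fuv|g gf] := @perm_extend _ (desc c) f.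
    by have /forall_inP/(_ v vc) := finj u uc; rewrite fuv eqxx => /eqP.
  exists g; apply: (@tree_iso_ext _ _ f) => [v /gf//|]; split=> //.
    by move=> v vc nvc; apply/eqP; exact: implyP (fp v vc) nvc.
  by move=> v vc; apply/eqP/fr.
case=> g [gc gi gp gr]; apply/existsP; exists (finfun g); apply/and5P; split.
- by rewrite ffunE gc.
- apply/forall_inP=> u _; apply/forall_inP=> v _; rewrite !ffunE.
  by rewrite (inj_eq perm_inj) implybb.
- by rewrite -gi; apply/eqP/eq_imset => v; rewrite ffunE.
- by apply/forall_inP=> v vc; apply/implyP=> nvc; rewrite !ffunE gp.
- by apply/forall_inP=> v vc; rewrite ffunE gr.
Qed.

(** An automorphism fixes [c], hence permutes its children and restricts to their subtrees.
    Conversely [c] lies outside the subtrees of its children, so it is fixed, and compatibility with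
    parents at a child only says that children go to children. *)
Lemma AutSub_blocks c (g : {perm node A}) : g \in AutSub c <->
  perm_on (\bigcup_(d in children c) desc d) g /\
  forall d, d \in children c -> exists2 e, e \in children c & tree_iso d e g.
Proof.
split.
  case/AutSubP=> gon gi; have [gc gim gp gr] := gi; split.
    apply/subsetP=> v vg; have vc := subsetP gon _ vg.
    have nvc : v != c by apply: contraTneq vg => ->; rewrite inE gc eqxx.
    by have [d dc vd] := desc_child vc nvc; apply/bigcupP; exists d.
  move=> d dc; exists (g d); last exact: tree_iso_desc gi (children_desc dc).
  apply: childrenI; first by rewrite -gc (inj_eq perm_inj) children_neq.
  by rewrite gp ?children_desc ?children_neq // (parent_child dc) gc.
case=> gon gi; have gc : g c = c.
  apply: (out_perm gon); apply/bigcupP=> -[d dc]; apply/negP.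
  exact: child_notin_desc.
have gon' : perm_on (desc c) g.
  apply/subsetP=> v /(subsetP gon)/bigcupP[d dc vd].
  exact: desc_trans (children_desc dc) vd.
apply/AutSubP; split=> //; split=> //; first exact: im_perm_on.
  move=> v vc nvc; have [d dc vd] := desc_child vc nvc.
  have [e ec [gd _ gp _]] := gi d dc; have [->|nvd] := eqVneq v d; last exact: gp.
  by rewrite gd !(parent_child dc) (parent_child ec).
move=> v vc; have [->|nvc] := eqVneq v c; first by rewrite gc.
have [d dc vd] := desc_child vc nvc; have [e _ [_ _ _ gr]] := gi d dc; exact: gr.
Qed.

Lemma rep_in c (S : {set node A}) : S != set0 -> rep c S \in S.
Proof.
by case/set0Pn=> x xS; rewrite /rep; case: pickP => [//|/(_ x)]; rewrite xS.
Qed.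

Lemma AutSub_giso c : giso (AutSub c) (AutRec c).
Proof.
apply: (giso_block_perms (B := @desc _ _ _ A)
  (iso := fun d e (g : {perm node A}) => tree_iso d e g)).
- by move=> d _; exists d; exact: desc_refl.
- exact: child_desc_inj.
- by move=> d e g [].
- by move=> d e g h _; exact: tree_iso_ext.
- exact: tree_iso1.
- exact: tree_isoM.
- exact: tree_isoV.
- by move=> d e _ _; exact: sub_isoP.
- exact: AutSub_blocks.
- by move=> d g _; exact: AutSubP.
- exact: rep_in.
Qed.

Lemma AutSub_leaf c : children c = set0 -> AutSub c = 1%g.
Proof.
move=> c0; apply/eqP; rewrite eqEsubset; apply/andP; split; apply/subsetP=> g.
  case/AutSub_blocks=> + _; rewrite c0 big_set0 => gon.
  by rewrite inE (perm_on_id gon) ?cards0.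
rewrite inE => /eqP->; apply/AutSubP; split; [exact: perm_on1|exact: tree_iso1].
Qed.

End FissionTree.

(** * Permutations of the points preserving the partitions *)

Section PartIsomorphisms.
Variables (R : realType) (n p : nat) (A : 'I_p -> 'I_n -> R[i]).
Implicit Types (u v c d e : node A) (a b : 'I_n) (l : nat) (g h : {perm 'I_n}).
Local Opaque desc children parent.

(** Only levels below that of [d] constrain [g]: from that level on, all points of the part are
    equivalent, before and after applying [g]. *)
Definition part_iso d e g : Prop :=
  [/\ level d = level e, g @: part d = part e &
      forall l, {in part d &, forall a b, same A l (g a) (g b) = same A l a b}].

Lemma part_iso_ext d e g h : {in part d, g =1 h} -> part_iso d e g -> part_iso d e h.
Proof.
move=> gh [ld gi gs]; split=> //.
  by rewrite -gi; apply/esym/eq_in_imset.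
by move=> l a b ad bd; rewrite -!gh ?gs.
Qed.

Lemma part_iso1 d : part_iso d d 1%g.
Proof.
split=> // [|l a b _ _]; last by rewrite !perm1.
by rewrite -[RHS]imset_id; apply: eq_imset => v; rewrite perm1.
Qed.

Lemma part_isoM d e f g h : part_iso d e g -> part_iso e f h -> part_iso d f (g * h)%g.
Proof.
move=> [ld gi gs] [le hi hs]; split; first by rewrite ld.
  by rewrite -hi -gi -imset_comp; apply: eq_imset => v; rewrite permM.
by move=> l a b ad bd; rewrite !permM hs ?gs // -gi imset_f.
Qed.

Lemma part_isoV d e g : part_iso d e g -> part_iso e d g^-1%g.
Proof.
move=> [ld gi gs]; split=> //.
  rewrite -gi -imset_comp -[RHS]imset_id; apply: eq_imset => v /=.
  by rewrite permK.
move=> l x y; rewrite -gi => /imsetP[a ad ->] /imsetP[b bd ->].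
by rewrite !permK gs.
Qed.

(** Classes at levels up to that of [e] that meet [part e] lie inside it, and [g] preserves
    equivalence in both directions, so it carries classes onto classes. *)
Lemma part_iso_node d e g v : part_iso d e g -> v \in desc d ->
  exists u, [/\ u \in desc e, level u = level v & part u = g @: part v].
Proof.
move=> [ld gi gs] vd; have [a av] := part_neq0 v.
have sv := subsetP (desc_part vd); have [u lu gau] := node_at A (g a) (level_bounds v).
have gae : g a \in part e by rewrite -gi imset_f ?sv.
have lue : level u <= level e by rewrite lu -ld (desc_level vd).
have sue := part_sub lue gau gae.
exists u; split; [exact: descI lue sue|exact: lu|apply/setP=> b].
apply/idP/imsetP => [bu|[b' b'v ->]].
  have := subsetP sue _ bu; rewrite -gi => /imsetP[b' b'd bE]; exists b' => //.
  by move: bu; rewrite bE (mem_part _ gau) lu gs ?(sv a) // -(mem_part _ av).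
by rewrite (mem_part _ gau) lu gs ?sv // -(mem_part _ av).
Qed.

Lemma node_eq_part u v : level u = level v -> part u = part v -> u = v.
Proof.
move=> luv suv; have [a au] := part_neq0 u.
by apply: (node_eq luv au); rewrite -suv.
Qed.

Lemma part_iso_sub_iso d e g : part_iso d e g -> sub_iso d e.
Proof.
move=> gi; have [ld gim gs] := gi.
(* The induced map on nodes sends [v] to the node of the same level whose part is the image of
   [part v]. *)
pose F v := odflt v [pick u | (level u == level v) && (part u == g @: part v)].
have FP v : v \in desc d -> [/\ F v \in desc e, level (F v) = level v & part (F v) = g @: part v].
  move=> vd; have [u [ue lu su]] := part_iso_node gi vd; rewrite /F.
  case: pickP => [w /andP[/eqP lw /eqP sw]|/(_ u)]; last by rewrite lu su !eqxx.
  by rewrite /= (@node_eq_part w u) // ?lw ?lu ?sw ?su.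
have Fin v vd := let: And3 x _ _ := FP v vd in x.
have Fl v vd := let: And3 _ x _ := FP v vd in x.
have Fs v vd := let: And3 _ _ x := FP v vd in x.
have dd := desc_refl d.
apply/existsP; exists (finfun F); apply/and5P; split.
- by rewrite ffunE; apply/eqP/node_eq_part; rewrite ?Fl ?Fs.
- apply/forall_inP=> u ud; apply/forall_inP=> v vd; rewrite !ffunE.
  apply/implyP=> /eqP Fuv; apply/eqP/node_eq_part; first by rewrite -(Fl u) // Fuv Fl.
  by apply: (imset_inj (@perm_inj _ g)); rewrite -!Fs // Fuv.
(* Surjectivity comes from the node that the inverse of [g] assigns to [u]. *)
- apply/eqP/setP=> u; apply/imsetP/idP => [[v vd ->]|ue]; first by rewrite ffunE Fin.
  have [v [vd lv sv]] := part_iso_node (part_isoV gi) ue.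
  exists v; rewrite // ffunE; apply: node_eq_part; first by rewrite Fl ?lv.
  rewrite Fs // sv -imset_comp -[LHS]imset_id; apply: eq_imset => b /=.
  by rewrite permKV.
- apply/forall_inP=> v vd; apply/implyP=> nvd; rewrite !ffunE.
  have pd := desc_parent vd nvd; have ltv := desc_level_lt vd nvd.
  have /andP[_ ldp] := level_bounds d; have lvp := leq_trans ltv ldp.
  have [lp sp] := parent_lt (v := v) lvp.
  have [lq sq] : level (parent (F v)) = (level (F v)).+1 /\ part (F v) \subset part (parent (F v)).
    by apply: parent_lt; rewrite Fl.
  have [a av] := part_neq0 v; apply/eqP/(node_eq (a := g a)).
  + by rewrite lq !Fl // lp.
  + by apply: (subsetP sq); rewrite Fs // imset_f.
  + by rewrite Fs // imset_f // (subsetP sp).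
- apply/forall_inP=> v vd; rewrite ffunE /rank Fs // card_imset //; exact: perm_inj.
Qed.

(** The children cover [part c], and equality of cardinalities makes the image all of [part c'].
    Below the level of [c], equivalent points lie in one child, where [g] is already controlled;
    points of different children stay in different children. *)
Lemma part_iso_glue c c' g :
    1 < level c -> level c = level c' -> #|part c| = #|part c'| ->
    (forall d, d \in children c -> exists2 e, e \in children c' & part_iso d e g) ->
  part_iso c c' g.
Proof.
move=> l1 lc cc gi.
have gc a : a \in part c -> g a \in part c'.
  move=> /(child_at l1)[d dc ad]; have [e ec [_ gim _]] := gi d dc.
  by apply: (subsetP (child_part ec)); rewrite -gim imset_f.
split=> //.
  apply/eqP; rewrite eqEcard card_imset ?cc ?leqnn ?andbT; last exact: perm_inj.
  by apply/subsetP=> _ /imsetP[a ac ->]; exact: gc.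
move=> l a b ac bc; case: (ltnP l (level c)) => [ll|ll]; last first.
  rewrite !(same_mono ll) //; first by rewrite -(mem_part _ ac).
  by rewrite lc -(mem_part _ (gc a ac)) gc.
have [d dc ad] := child_at l1 ac; have [d' d'c bd'] := child_at l1 bc.
have [e ec gde] := gi d dc; have [e' e'c gde'] := gi d' d'c.
have [_ gim gs] := gde; have [_ gim' _] := gde'.
have gae : g a \in part e by rewrite -gim imset_f.
have gbe' : g b \in part e' by rewrite -gim' imset_f.
have lle : l <= level e by rewrite -ltnS -(child_level ec) -lc.
have lld : l <= level d by rewrite -ltnS -(child_level dc).
have [dd'|ndd'] := eqVneq d d'; first by rewrite gs // dd'.
transitivity false; [|apply/esym]; apply/negbTE/negP=> sab; case/negP: ndd'; apply/eqP.
  have gbe : g b \in part e by rewrite (mem_part _ gae) (same_mono lle).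
  have ee' := child_inj ec e'c gbe gbe'.
  apply: (child_inj dc d'c ad); have : g a \in part e' by rewrite -ee'.
  by rewrite -gim' mem_imset //; exact: perm_inj.
by apply: (child_inj dc d'c _ bd'); rewrite (mem_part _ ad) (same_mono lld).
Qed.

(* Conversely a tree isomorphism lifts to the points: bijections between leaves
   of equal rank are glued level by level. *)
Lemma sub_iso_part_iso d e : level d = level e -> sub_iso d e -> exists g, part_iso d e g.
Proof.
move=> + /sub_isoP[f fi]; have [k] := ubnP (level d).
elim: k d e fi => [d e _ /[!ltn0] /notF[]|k IH d e fi ldk lde].
have [fd fim fp fr] := fi.
have cde : #|part d| = #|part e| by have := fr d (desc_refl d); rewrite fd.
case: (ltnP 1 (level d)) => [l1|l1]; last first.
  (* At a leaf any bijection works, because its points are equivalent at every level. *)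
  have [g gde] := perm_imset_card cde; exists g; split=> // l a b ad bd.
  have s1 x y v : level v <= 1 -> x \in part v -> y \in part v -> same A l x y.
    move=> lv xv; rewrite (mem_part _ xv) => /(same_mono lv) s1.
    by case: l => [|l]; [rewrite same0|apply: same_mono s1].
  by rewrite (s1 a b d) // (s1 (g a) (g b) e) -?lde -?gde ?imset_f.
have child_iso x : x \in children d -> f x \in children e /\ exists g, part_iso x (f x) g.
  move=> xd; have xdd := children_desc xd.
  have fxe : f x \in children e.
    apply: childrenI; first by rewrite -fd (inj_eq perm_inj) children_neq.
    by rewrite (fp x xdd (children_neq xd)) (parent_child xd).
  split; first exact: fxe.
  apply: (IH _ _ (tree_iso_desc fi xdd)).
    by rewrite -ltnS -(child_level xd).
  by apply: succn_inj; rewrite -(child_level xd) -(child_level fxe).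
have /choice[G GP] : forall x, exists g, x \in children d -> part_iso x (f x) g.
  move=> x; case: (boolP (x \in children d)) => [/child_iso[_ [g gx]]|_]; first by exists g.
  by exists 1%g.
(* The lifts chosen for the children are glued; the values off [part d] are irrelevant, and
   [perm_extend] then gives a permutation. *)
pose g0 a := if [pick x in children d | a \in part x] is Some x then G x a else a.
have g0E x a : x \in children d -> a \in part x -> g0 a = G x a.
  move=> xd ax; rewrite /g0; case: pickP => [y /andP[yd ay]|/(_ x)].
    by rewrite (child_inj xd yd ax ay).
  by rewrite xd ax.
have g0in x a : x \in children d -> a \in part x -> g0 a \in part (f x).
  move=> xd ax; rewrite (g0E x) //; have [_ <- _] := GP x xd; exact: imset_f.
have g0inj : {in part d &, injective g0}.
  move=> a b /(child_at l1)[x xd ax] /(child_at l1)[y yd yb] ab.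
  have ga := g0in _ _ xd ax; have gb := g0in _ _ yd yb; rewrite -ab in gb.
  have [fx _] := child_iso x xd; have [fy _] := child_iso y yd.
  have xy : x = y by apply: (@perm_inj _ f); exact: child_inj fx fy ga gb.
  move: ab; rewrite (g0E x a) // (g0E x b) ?xy //; exact: perm_inj.
have [g gE] := perm_extend g0inj; exists g; apply: part_iso_glue => // x xd.
exists (f x); first by have [] := child_iso x xd.
apply: part_iso_ext (GP x xd) => a ax; rewrite gE ?(g0E x) //.
exact: (subsetP (child_part xd)).
Qed.

(** * Automorphism groups of parts and their recursion *)

Definition PartAut c : {set {perm 'I_n}} :=
  [set g | perm_on (part c) g && `[< part_iso c c g >]].

Lemma PartAutP c g : g \in PartAut c <-> perm_on (part c) g /\ part_iso c c g.
Proof. by rewrite inE; split=> [/andP[? /asboolP]//|[-> ?]]; apply/asboolP. Qed.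

Lemma bigcup_child_part c : 1 < level c -> \bigcup_(d in children c) part d = part c.
Proof.
move=> l1; apply/setP=> a; apply/bigcupP/idP => [[d dc]|/(child_at l1)[d dc ad]].
  exact: (subsetP (child_part dc)).
by exists d.
Qed.

Lemma PartAut_blocks c g : 1 < level c -> g \in PartAut c <->
  perm_on (\bigcup_(d in children c) part d) g /\
  forall d, d \in children c -> exists2 e, e \in children c & part_iso d e g.
Proof.
move=> l1; rewrite bigcup_child_part //; split.
  case/PartAutP=> gon gi; have [_ gim gs] := gi; split=> // d dc.
  have [e [ec le pe]] := part_iso_node gi (children_desc dc).
  exists e.
    by rewrite mem_children le -(child_level dc) eqxx (desc_part ec).
  split=> // l a b ad bd; apply: gs; exact: (subsetP (child_part dc)).
by case=> gon gi; apply/PartAutP; split=> //; exact: part_iso_glue.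
Qed.

Lemma PartAut_giso c : 1 < level c ->
  giso (PartAut c)
    (prod_on (mem (Defs.classes c)) (fun S => wr_on S (PartAut (rep c S)))).
Proof.
move=> l1; apply: (giso_block_perms (B := @part _ _ _ A) (iso := part_iso)).
- by move=> d _; exact: part_neq0.
- exact: child_inj.
- by move=> d e g [].
- by move=> d e g h _; exact: part_iso_ext.
- exact: part_iso1.
- exact: part_isoM.
- exact: part_isoV.
(* The classes are defined by isomorphism of subtrees; for children of one node this amounts to
   isomorphism of their parts. *)
- move=> d e dc ec; split=> [|[g]]; last exact: part_iso_sub_iso.
  by apply: sub_iso_part_iso; apply: succn_inj; rewrite -(child_level dc) -(child_level ec).
- by move=> g; exact: PartAut_blocks.
- by move=> d g _; exact: PartAutP.
- exact: rep_in.
Qed.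

(** At a leaf every permutation supported on the part qualifies. Conjugation by a permutation taking
    the part to the first [rank c] points gives the symmetric group in the form used by [Atil]. *)
Lemma PartAut_leaf c : level c = 1 -> giso (PartAut c) (Atil 0 c).
Proof.
move=> lc.
have [h hE] : exists h, h @: part c = [set i : 'I_n | i < rank c].
  apply: perm_imset_card.
  have rn : rank c <= n by rewrite -[leqRHS]card_ord max_card.
  rewrite -[RHS]sum1_card (eq_bigl (fun i : 'I_n => i < rank c)) => [|i]; last by rewrite inE.
  by rewrite (big_ord_narrow rn) sum1_card card_ord.
have PA g : (g \in PartAut c) = perm_on (part c) g.
  apply/idP/idP => [/PartAutP[]//|gon]; apply/PartAutP; split=> //.
  split=> [//||l a b ac bc]; first exact: im_perm_on.
  have s1 x y : x \in part c -> y \in part c -> same A l x y.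
    move=> xc; rewrite (mem_part _ xc) lc => s1.
    by case: l => [|l]; [rewrite same0|apply: same_mono s1].
  by rewrite !s1 ?(perm_closed _ gon).
have onJ (S T : {set 'I_n}) g (k : {perm 'I_n}) : k @: S = T -> perm_on S g -> perm_on T (g ^ k)%g.
  move=> kE gon; apply/subsetP=> x; rewrite inE; apply: contraR => xT.
  rewrite conjgE !permM (out_perm gon) ?permKV //.
  by apply: contra xT => xS; rewrite -kE -[x](permKV k) imset_f.
have hVE : (h^-1)%g @: [set i : 'I_n | i < rank c] = part c.
  rewrite -hE -imset_comp -[RHS]imset_id; apply: eq_imset => i /=.
  by rewrite permK.
exists (conjg^~ h), (conjg^~ h^-1%g); split.
- by move=> g; rewrite PA inE => gon; exact: onJ gon.
- by move=> g; rewrite PA inE => gon; exact: onJ gon.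
- by move=> g _; rewrite conjgK.
- by move=> g _; rewrite conjgKV.
- by move=> g k _ _; rewrite conjMg.
Qed.

Lemma PartAut_Atil k c : level c = k.+1 -> giso (PartAut c) (Atil k c).
Proof.
elim: k c => [|k IH] c lc; first exact: PartAut_leaf.
have l1 : 1 < level c by rewrite lc.
apply: giso_trans (PartAut_giso l1) _; apply: giso_prod_on => S.
case/imsetP=> d dc SE; apply/giso_wr_on/IH; apply: succn_inj.
rewrite -lc -(@child_level _ _ _ _ _ c) //.
(* The representative belongs to a nonempty class of children of [c], so its level is one less, as
   the induction requires. *)
suff: rep c S \in S by rewrite {2}SE inE => /andP[].
apply/rep_in/set0Pn; exists d; rewrite SE inE dc.
exact: part_iso_sub_iso (part_iso1 d).
Qed.

End PartIsomorphisms.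

(** * The stabilizer of the kernel flag *)

Section Stabilizer.
Variables (R : realType) (n p : nat) (A : 'I_p -> 'I_n -> R[i]).
Import GRing.Theory Num.Theory.

Lemma inUP l (x : 'I_n -> R[i]) : inU A l x <->
  (\sum_a x a = 0)%R /\ forall a b, same A l a b -> x a = x b.
Proof.
split=> -[x0 xl]; split=> //.
  by move=> a b sab; apply: (xl [set b | same A l a b]); rewrite ?inE ?same_refl ?imset_f.
move=> L a b /imsetP[c _ ->]; rewrite !inE => sa sb.
by apply: xl; apply: same_trans sb; rewrite same_sym.
Qed.

(* Number the classes of [same A l] and subtract the mean. *)
Lemma inU_separates l : 0 < n ->
  exists2 x : 'I_n -> R[i], inU A l x & forall a b, x a = x b -> same A l a b.
Proof.
move=> n0; pose y a : R[i] := ((enum_rank [set b | same A l a b])%:R)%R.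
pose m : R[i] := ((\sum_a y a) / n%:R)%R.
exists (fun a => (y a - m)%R) => [|a b /addIr/eqP].
  apply/inUP; split=> [|a b sab].
    rewrite sumrB sumr_const card_ord -mulr_natr /m mulfVK ?subrr //.
    by rewrite pnatr_eq0 -lt0n.
  congr (_%:R - _)%R; congr (nat_of_ord (enum_rank _)); apply/setP=> c; rewrite !inE.
  by apply/idP/idP; apply: same_trans; rewrite // same_sym.
rewrite eqr_nat => /eqP/val_inj/enum_rank_inj/setP/(_ b).
by rewrite !inE same_refl => ->.
Qed.

(** In a finite group [w] is a power of its inverse, so preservation in one direction gives the
    other. *)
Lemma perm_pres_same l (w : {perm 'I_n}) :
    (forall a b, same A l a b -> same A l (w^-1 a)%g (w^-1 b)%g) ->
  forall a b, same A l (w a) (w b) = same A l a b.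
Proof.
move=> wV a b; apply/idP/idP => [/wV|]; first by rewrite !permK.
have wX k : same A l a b -> same A l (((w^-1) ^+ k)%g a) (((w^-1) ^+ k)%g b).
  elim: k => [|k IH] sab; first by rewrite !perm1.
  by rewrite expgSr !permM; apply/wV/IH.
by have := wX (#[(w^-1)]%g).-1; rewrite -invg_expg invgK.
Qed.

Lemma StabP (w : {perm 'I_n}) : 0 < n ->
  w \in Stab A <-> forall l a b, same A l (w a) (w b) = same A l a b.
Proof.
move=> n0; rewrite inE; split.
  move/asboolP=> wU l a b; case: (ltnP p l) => [pl|]; first by rewrite !same_top.
  have wl k : 0 < k <= p -> same A k (w a) (w b) = same A k a b.
    move=> kp; apply: perm_pres_same => a' b' sab.
    (* After the action of [w], the separating vector is still constant on parts; separation then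
       shows that the inverse of [w] preserves the equivalence. *)
    have [x xU xs] := inU_separates k n0.
    by have /inUP[_ xw] := wU k kp x xU; apply/xs/xw.
  (* Level 0 reduces to level 1, which is within range unless [p] is 0, where all points are
     equivalent. *)
  case: l => [|l] lp; last exact: wl.
  case: (posnP p) => [p0|p0]; last by rewrite !same0 wl ?p0.
  by rewrite !same0 !same_top ?p0.
move=> ws; apply/asboolP=> l _ x /inUP[x0 xl]; apply/inUP; split.
  by rewrite -[RHS]x0 /wact [RHS](reindex_inj (@perm_inj _ (w^-1)%g)).
by move=> a b sab; apply: xl; rewrite -ws !permKV.
Qed.

Lemma Stab_PartAut (rt : node A) : 0 < n -> val rt = (ord_max, [set: 'I_n]) ->
  Stab A = PartAut rt.
Proof.
move=> n0 rtE; have prt : part rt = [set: 'I_n] by rewrite /part rtE.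
apply/setP=> w; apply/idP/idP => [/StabP ws|/PartAutP[_ [_ _ ws]]].
  have won : perm_on (part rt) w by rewrite prt; apply/subsetP=> a _; rewrite inE.
  apply/PartAutP; split=> //; split=> // [|l a b _ _]; first exact: im_perm_on.
  exact: ws.
by apply/StabP => // l a b; apply: ws; rewrite prt inE.
Qed.

End Stabilizer.

Theorem theorem4p13 (R : realType) (n p : nat) (A : 'I_p -> 'I_n -> R[i])
  (hn : 2 <= n) (hp : 1 <= p)
  (hA : forall j : 'I_p, (\sum_(a < n) A j a)%R = 0%R)
  (rt : node A) (hrt : val rt = (ord_max, [set: 'I_n])) :
  (* (i) Stab_{W_g}(U) ~= \tilde Aut(T, r) *)
  (Stab A \isog Atil p rt)
  (* (ii) Aut(T, r) ~= prod_{t} S_{n(t)} \wr Aut(t, r|_t) *)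
  /\ (AutSub rt \isog AutRec rt)
  (* the automorphism group of a single-node ranked tree is trivial *)
  /\ (forall c : node A, children c = set0 -> AutSub c = 1%g).
Proof.
split; [|split; last exact: AutSub_leaf].
  rewrite (Stab_PartAut (ltnW hn) hrt); apply: giso_isog.
    by apply/PartAutP; split; [exact: perm_on1|exact: part_iso1].
  (* The root has level [p.+1], hence height [p]. *)
  by apply: PartAut_Atil; rewrite /level hrt.
apply: giso_isog (AutSub_giso rt).
by apply/AutSubP; split; [exact: perm_on1|exact: tree_iso1].
Qed.
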